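(* Let $Y,Z$ be topological spaces, equip $Y$ with a $\mathbb{Z}$-action generated by $\rho\colon Y\to Y$, and equip $Z$ with a $\mathbb{Z}/2$-action generated by $\sigma\colon Z\to Z$. Let $\phi\colon Y\to Z$ be continuous and equivariant, i.e., $\sigma\circ\phi=\phi\circ\rho$. Let $\preceq$ be a preorder on $Y$ and let $s\colon(0,1]\times Y^{2}_{\preceq}\to PY$ be a lifted motion planning algorithm for $(Y,Z,\phi,\preceq)$ such that: (1) $y\preceq\rho(y)$ for all $y\in Y$; (2) for all $y_0,y_1\in Y$, $\rho(y_{0})\preceq\rho(y_{1})$ if and only if $y_{0}\preceq y_{1}$; (3) for all $y_0,y_1\in Y$, $y_{0}\preceq y_{1}$ implies $y_{0}\preceq s_{w}(y_{0},y_{1})(t)\preceq y_{1}$ for all $w\in(0,1]$, $t\in[0,1]$. Then for each integer $n\ge 0$ there exists a $\mathbb{Z}/2$-map $\beta_{n}\colon S^{n}\to Z$. Moreover, for any choice of initial point $y^{*}\in Y$, the maps $\beta_{n}$ can be chosen such that $\beta_{n}$ maps each positive point of $S^{n}$ to a point in $Z$ of the form $\phi(y)$ with $y\in Y$ and $y^{*}\preceq y\preceq\rho^{n}(y^{*})$; that is, the subspace of $Z$ consisting of these points $\phi(y)$ (with $y^{*}\preceq y\preceq\rho^{n}(y^{*})$) and their antipodes $\sigma(\phi(y))$ has $\mathbb{Z}/2$-coindex at least $n$.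
   Context: Group actions are by continuous maps; so $\rho$ is a homeomorphism of $Y$, and $\sigma$ is a continuous map with $\sigma\circ\sigma=\mathrm{id}_Z$. A preorder is a reflexive and transitive relation. $PY$ is the space of continuous paths $\gamma\colon[0,1]\to Y$ with the compact-open topology. For a preorder $\preceq$ on $Y$, $Y^{2}_{\preceq}=\{(y_{0},y_{1})\in Y^{2}:y_{0}\preceq y_{1}\}$, with the subspace topology from the product topology on $Y^{2}$. A lifted motion planning algorithm (lifted mpa) for $(Y,Z,\phi,\preceq)$, where $\phi\colon Y\to Z$ is continuous, is a family of maps $s_{w}\colon Y^{2}_{\preceq}\to PY$, $w\in(0,1]$, with $s_{w}(y_{0},y_{1})(0)=y_{0}$ and $s_{w}(y_{0},y_{1})(1)=y_{1}$, assembling into a continuous map $s\colon(0,1]\times Y^{2}_{\preceq}\to PY$, $s(w,y_0,y_1)=s_w(y_0,y_1)$, with the following continuity property: for all $y\in Y$ and all neighborhoods $V$ of $\phi(y)$ in $Z$, there exist a neighborhood $U$ of $\phi(y)$ in $Z$ and $\delta>0$ such that if $(y_0,y_1)\in Y^2_{\preceq}$, $\phi(y_{0}),\phi(y_{1})\in U$ and $w\in(0,1]$ with $w<\delta$, then $\phi(s_{w}(y_{0},y_{1})(t))\in V$ for all $t\in[0,1]$. The sphere $S^n\subset\mathbb{R}^{n+1}$ carries the antipodal action $x\mapsto -x$. A $\mathbb{Z}/2$-map $f\colon S^n\to Z$ is a continuous map with $f(-x)=\sigma(f(x))$ for all $x\in S^n$. The $\mathbb{Z}/2$-coindex of a space with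 $\mathbb{Z}/2$-action is the largest integer $m$ such that there is a $\mathbb{Z}/2$-map from $S^m$ to it; ''coindex at least $n$'' means that there is a $\mathbb{Z}/2$-map from $S^n$ to it. A point $x=(x_1,\ldots,x_{n+1})\in S^{n}$ is positive if its last nonzero coordinate is positive, and negative otherwise. *)

(* Defs.v *)
From HB Require Import structures.
From mathcomp Require Import all_boot all_order all_algebra.
From mathcomp Require Import all_classical all_reals all_analysis.

Set Implicit Arguments.
Unset Strict Implicit.
Unset Printing Implicit Defensive.
Import Order.TTheory GRing.Theory Num.Theory.
Import numFieldNormedType.Exports.

Local Open Scope classical_set_scope.
Local Open Scope ring_scope.

(* Subsets are used as types through [set_type], which carries the subspace
   (initial) topology; [\val] is the inclusion. *)

Definition homeomorphism (X Y : topologicalType) (f : X -> Y) : Prop :=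
  continuous f /\
  exists g : Y -> X, [/\ cancel f g, cancel g f & continuous g].

Definition unit_interval (R : realType) : Type :=
  set_type (`[0, 1]%classic : set R).
HB.instance Definition _ (R : realType) := Topological.on (unit_interval R).

Fact unit_interval0_subproof (R : realType) : 0 \in (`[0, 1]%classic : set R).
Proof. by apply/mem_set; rewrite /= in_itv /= lexx ler01. Qed.

Fact unit_interval1_subproof (R : realType) : 1 \in (`[0, 1]%classic : set R).
Proof. by apply/mem_set; rewrite /= in_itv /= lexx ler01. Qed.

Definition unit_interval0 (R : realType) : unit_interval R :=
  exist _ 0 (unit_interval0_subproof R).

Definition unit_interval1 (R : realType) : unit_interval R :=
  exist _ 1 (unit_interval1_subproof R).

Definition weight (R : realType) : Type := set_type (`]0, 1]%classic : set R).
HB.instance Definition _ (R : realType) := Topological.on (weight R).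

(* Continuous paths, topologized as a subspace of the compact-open topology on
   all functions; a path coerces to its underlying function. *)
Definition path_space (R : realType) (Y : topologicalType) : Type :=
  continuousType (unit_interval R) Y.
HB.instance Definition _ (R : realType) (Y : topologicalType) :=
  Topological.copy (path_space R Y)
    (initial_topology
      ((fun g : continuousType (unit_interval R) Y => g : _ -> _)
       : continuousType (unit_interval R) Y ->
         {compact-open, unit_interval R -> Y})).

Definition le_pairs (Y : topologicalType) (le : Y -> Y -> Prop) : Type :=
  set_type [set p : Y * Y | le p.1 p.2].
HB.instance Definition _ (Y : topologicalType) (le : Y -> Y -> Prop) :=
  Topological.on (le_pairs le).

Record lifted_mpa (R : realType) (Y Z : topologicalType) (phi : Y -> Z)
    (le : Y -> Y -> Prop) (s : weight R * le_pairs le -> path_space R Y)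
    : Prop := {
  lifted_mpa_continuous : continuous s;
  lifted_mpa_start : forall w p, s (w, p) (unit_interval0 R) = (\val p).1;
  lifted_mpa_end : forall w p, s (w, p) (unit_interval1 R) = (\val p).2;
  lifted_mpa_small : forall (y : Y) (V : set Z), nbhs (phi y) V ->
    exists (U : set Z) (delta : R), [/\ nbhs (phi y) U, 0 < delta &
      forall (w : weight R) (p : le_pairs le),
        U (phi (\val p).1) -> U (phi (\val p).2) -> \val w < delta ->
        forall t : unit_interval R, V (phi (s (w, p) t))]
}.

(* The Euclidean unit sphere; the library norm on ['rV[R]_n.+1] is the sup norm,
   so the sphere is not given by [`|x| = 1]. *)
Definition sphere_set (R : realType) (n : nat) : set 'rV[R]_n.+1 :=
  [set x | \sum_i x 0 i ^+ 2 = 1].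

Definition sphere (R : realType) (n : nat) : Type :=
  set_type (@sphere_set R n).
HB.instance Definition _ (R : realType) (n : nat) :=
  Topological.copy (sphere R n) (set_type (@sphere_set R n)).

Fact antipode_subproof (R : realType) (n : nat) (x : sphere R n) :
  - \val x \in @sphere_set R n.
Proof.
apply/mem_set; rewrite /sphere_set /=.
under eq_bigr do rewrite mxE sqrrN.
exact: set_mem (valP x).
Qed.

Definition antipode (R : realType) (n : nat) (x : sphere R n) : sphere R n :=
  exist _ (- \val x) (antipode_subproof x).

Definition positive_point (R : realType) (n : nat) (x : sphere R n) : Prop :=
  exists i : 'I_n.+1, 0 < \val x 0 i /\
    forall j : 'I_n.+1, (i < j)%N -> \val x 0 j = 0.

Definition Z2_action (T : topologicalType) (sigma : T -> T) : Prop :=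
  continuous sigma /\ involutive sigma.

Definition Z2_map (R : realType) (n : nat) (T : topologicalType)
    (sigma : T -> T) (f : sphere R n -> T) : Prop :=
  continuous f /\ forall x, f (antipode x) = sigma (f x).

Definition Z2_coindex_ge (R : realType) (n : nat) (T : topologicalType)
    (sigma : T -> T) : Prop :=
  exists f : sphere R n -> T, Z2_map sigma f.

Definition stable_set (T : Type) (sigma : T -> T) (A : set T) : Prop :=
  forall z, A z -> A (sigma z).

Definition restr_action (T : topologicalType) (sigma : T -> T) (A : set T)
    (hA : stable_set sigma A) (z : A) : A :=
  exist _ (sigma (\val z)) (mem_set (hA _ (set_mem (valP z)))).

Definition order_interval (Y : Type) (le : Y -> Y -> Prop) (a b : Y) : set Y :=
  [set y | le a y /\ le y b].

(* Main.v *)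
(** The map [beta_n] is [phi \o b_n] for a possibly discontinuous [b_n] with
    values in [Y], built by induction on [n]; [b_0] takes the values [ystar] and
    [rho ystar].  Projecting the open upper hemisphere of [S^(n+1)] to the open
    ball sends a point [(x', u, v)], [v > 0], to a point of the vertical chord
    of [S^n] with ends [(x', h)] and [(x', -h)], and [b_(n+1)] follows there the
    path [s_h] from [b_n (x', h)] to [b_n (x', -h) = rho (b_n (-x', h))].  These
    two values are comparable because every value on that path is at most
    [rho (b_n (-x', h))], while every value on the path through the opposite
    chord is at least [b_n (-x', h)].  On the lower hemisphere [b_(n+1)] is
    given by [rho] and the antipode, on the equator it is [b_n].  The only
    points where [phi \o b_(n+1)] could fail to be continuous are the
    degenerate chords [h = 0]; there the two ends have nearby images in [Z] and
    the weight [h] tends to [0], so the smallness property of the lifted motion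
    planning algorithm applies.

    The formulas make sense on all of [R^(n+1)] minus the origin if one puts
    [h = sqrt (u^2 + v^2)], so the norm constraint is never needed. *)

Require Import Defs.
From Corelib Require Relation_Definitions.
From mathcomp Require Import all_boot all_order all_algebra.
From mathcomp Require Import all_classical all_reals all_analysis.
From mathcomp Require Import lra.
Import Order.TTheory GRing.Theory Num.Theory.
Import numFieldNormedType.Exports.
Local Open Scope classical_set_scope.
Local Open Scope ring_scope.

Set Implicit Arguments.
Unset Strict Implicit.
Unset Printing Implicit Defensive.

(** * Subspaces, the unit interval and evaluation of paths *)

Lemma cvg_set_type (T : topologicalType) (A : set T) (I : Type)
    (F : set_system I) (FF : Filter F) (f : I -> A) (a : A) :
  \val (f i) @[i --> F] --> \val a -> f @ F --> a.
Proof.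
move=> fa U [/= _ [[W oW <-] /= Wa] WU].
have FW := fa W (open_nbhs_nbhs (conj oW Wa)).
by apply: (@filterS _ F FF _ _ _ FW) => i Wi; exact: WU.
Qed.

Lemma cvg_insubd (T : topologicalType) (A : set T) (d : A) (I : Type)
    (F : set_system I) (FF : Filter F) (f : I -> T) (a : T) :
  A a -> (\forall i \near F, A (f i)) -> f @ F --> a ->
  (insubd d (f i) : A) @[i --> F] --> (insubd d a : A).
Proof.
move=> Aa Af fa; apply: cvg_set_type; rewrite val_insubd mem_set//.
apply: cvg_trans fa; apply: near_eq_cvg.
by near do rewrite val_insubd mem_set//.
Unshelve. all: by end_near. Qed.

Definition clamp {R : realType} (r : R) : unit_interval R :=
  insubd (unit_interval0 R) (Order.max 0 (Order.min r 1)).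

Lemma val_clamp (R : realType) (r : R) :
  \val (clamp r) = Order.max 0 (Order.min r 1).
Proof.
rewrite val_insubd mem_set//= in_itv/= le_max lexx/=.
by rewrite ge_max ler01 ge_min lexx orbT.
Qed.

Lemma clamp_le0 (R : realType) (r : R) : r <= 0 -> clamp r = unit_interval0 R.
Proof.
move=> r0; apply/val_inj; rewrite val_clamp.
by rewrite min_l ?(le_trans r0 ler01)// max_l.
Qed.

Lemma clamp_ge1 (R : realType) (r : R) : 1 <= r -> clamp r = unit_interval1 R.
Proof. by move=> r1; apply/val_inj; rewrite val_clamp min_r// max_r. Qed.

Lemma clamp_val (R : realType) (t : unit_interval R) : clamp (\val t) = t.
Proof.
apply/val_inj; rewrite val_clamp; have := set_mem (valP t).
by rewrite /= in_itv/= => /andP[t0 t1]; rewrite min_l// max_r.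
Qed.

Lemma continuous_clamp (R : realType) : continuous (@clamp R).
Proof.
move=> r; apply: cvg_set_type; rewrite val_clamp.
under eq_cvg do rewrite val_clamp.
apply: (@continuous_max R R (cst 0) (Order.min^~ 1) r); first exact: cvg_cst.
apply: (@continuous_min R R id (cst 1) r); [exact: cvg_id|exact: cvg_cst].
Qed.

(** The segment in [R] is compact and [clamp] maps it onto the subtype. *)
Lemma compact_unit_interval (R : realType) : compact [set: unit_interval R].
Proof.
have -> : [set: unit_interval R] = @clamp R @` `[0, 1].
  apply/seteqP; split=> // t _; exists (\val t); last exact: clamp_val.
  exact: set_mem (valP t).
apply: continuous_compact; last exact: segment_compact.
exact/continuous_subspaceT/continuous_clamp.
Qed.

(** Evaluation is the uncurrying of the inclusion into the compact-open function space; uncurrying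
    preserves continuity here because the unit interval is compact and regular. *)
Lemma continuous_path_eval (R : realType) (Y : topologicalType) :
  continuous (fun p : path_space R Y * unit_interval R => p.1 p.2).
Proof.
pose f (g : path_space R Y) (t : unit_interval R) : Y := g t.
rewrite (_ : (fun p => _) = uncurry f); last by apply/funext => -[].
apply: continuous_uncurry_regular.
- move=> t _; rewrite withinET; exists setT; first exact: filterT.
  split; [exact: compact_unit_interval|exact: closedT].
- exact: (@uniform_regular (set_type (`[0, 1]%classic : set R))).
- exact: initial_continuous.
- by move=> ?; exact: cts_fun.
Qed.

(** * The motion planner with real weights and times *)

Fact weight1_subproof (R : realType) : 1 \in (`]0, 1]%classic : set R).
Proof. by apply/mem_set; rewrite /= in_itv /= lexx ltr01. Qed.

Definition weight1 (R : realType) : weight R := exist _ 1 (weight1_subproof R).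

Lemma cvg_at (T U : topologicalType) (g : T -> U) (I : Type)
    (F : set_system I) (FF : Filter F) (u : I -> T) (a : T) :
  {for a, continuous g} -> u @ F --> a -> g (u i) @[i --> F] --> g a.
Proof. by move=> cg cu V /cg gV; exact: (cu _ gV). Qed.

Lemma cvg_pairing (T U : topologicalType) (I : Type) (F : set_system I)
    (FF : Filter F) (u : I -> T) (v : I -> U) (a : T) (b : U) :
  u @ F --> a -> v @ F --> b -> (u i, v i) @[i --> F] --> (a, b).
Proof. by move=> cu cv; exact: cvg_pair. Qed.

Section motion.
Context (R : realType) (Y Z : topologicalType) (phi : Y -> Z).
Context (le : Y -> Y -> Prop) (s : weight R * le_pairs le -> path_space R Y).
Context (default_pair : le_pairs le).
Hypothesis s_mpa : lifted_mpa phi s.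

(* Junk values: weights above [1] are truncated, other weights outside ]0, 1]
   become [1], incomparable pairs become [default_pair], times are clamped. *)
Definition motion (w : R) (y0 y1 : Y) (t : R) : Y :=
  s (insubd (weight1 R) (Order.min w 1), insubd default_pair (y0, y1))
    (clamp t).

Lemma val_weight (w : R) : 0 < w ->
  \val (insubd (weight1 R) (Order.min w 1)) = Order.min w 1.
Proof.
move=> w0; rewrite val_insubd mem_set//= in_itv/= lt_min w0 ltr01.
by rewrite ge_min lexx orbT.
Qed.

Lemma val_le_pair (y0 y1 : Y) : le y0 y1 ->
  \val (insubd default_pair (y0, y1) : le_pairs le) = (y0, y1).
Proof. by move=> le01; rewrite val_insubd mem_set. Qed.

Lemma motion_le0 w y0 y1 t : le y0 y1 -> t <= 0 -> motion w y0 y1 t = y0.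
Proof.
move=> le01 t0; rewrite /motion clamp_le0// (lifted_mpa_start s_mpa).
by rewrite val_le_pair.
Qed.

Lemma motion_ge1 w y0 y1 t : le y0 y1 -> 1 <= t -> motion w y0 y1 t = y1.
Proof.
move=> le01 t1; rewrite /motion clamp_ge1// (lifted_mpa_end s_mpa).
by rewrite val_le_pair.
Qed.

(** Near the limit weights are positive and pairs comparable, so the default values do not
    interfere, and continuity of [s] and of path evaluation applies. Comparability is assumed along
    the filter since it need not be an open condition. *)
Lemma motion_cvg (I : Type) (F : set_system I) (FF : Filter F)
    (w t : I -> R) (y0 y1 : I -> Y) (w' t' : R) (y0' y1' : Y) :
  0 < w' -> le y0' y1' -> (\forall i \near F, le (y0 i) (y1 i)) ->
  w @ F --> w' -> y0 @ F --> y0' -> y1 @ F --> y1' -> t @ F --> t' ->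
  motion (w i) (y0 i) (y1 i) (t i) @[i --> F] --> motion w' y0' y1' t'.
Proof.
move=> w'0 le01 near_le cw c0 c1 ct.
have cmin : Order.min (w i) 1 @[i --> F] --> Order.min w' 1.
  have cmin : {for w', continuous (fun r : R => Order.min r 1)}.
    by apply: (@continuous_min R R id (cst 1)); [exact: cvg_id|exact: cvg_cst].
  exact: (cvg_at FF cmin cw).
have Aw : (`]0, 1]%classic : set R) (Order.min w' 1).
  by rewrite /= in_itv/= lt_min w'0 ltr01 ge_min lexx orbT.
have near_w : \forall i \near F, (`]0, 1]%classic : set R) (Order.min (w i) 1).
  have : \forall i \near F, 0 < w i by exact: (cvgr_gt _ cw).
  apply: (@filterS _ F FF) => i wi0.
  by rewrite /= in_itv/= lt_min wi0 ltr01 ge_min lexx orbT.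
have cW := @cvg_insubd _ _ (weight1 R) _ _ FF _ _ Aw near_w cmin.
have cp : (y0 i, y1 i) @[i --> F] --> (y0', y1') by exact: cvg_pair.
have cP := @cvg_insubd _ [set p : Y * Y | le p.1 p.2] default_pair _ _ FF
  (fun i => (y0 i, y1 i)) (y0', y1') le01 near_le cp.
have cC : clamp (t i) @[i --> F] --> clamp t'.
  exact: (cvg_at FF (@continuous_clamp R t')).
have cWP := cvg_pairing FF cW cP.
have cs := cvg_at FF (@lifted_mpa_continuous _ _ _ _ _ _ s_mpa (_, _)) cWP.
have csC := cvg_pairing FF cs cC.
exact: (cvg_at FF (@continuous_path_eval R Y (_, _)) csC).
Qed.

End motion.

(** * Chords, reflections and signs in coordinates *)

Section coordinates.
Context {R : realType}.
Implicit Types (x : nat -> R) (n : nat) (h : R).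

Definition nonzero_upto n x : Prop := exists2 i, (i <= n)%N & x i != 0.

Definition positive_upto n x : Prop :=
  exists i, [/\ (i <= n)%N, 0 < x i & forall j, (i < j <= n)%N -> x j = 0].

(* On [S^(n+1)] this is [sqrt (1 - |x'|^2)], where [x'] consists of the first
   [n] coordinates of [x]. *)
Definition half_chord n x : R := Num.sqrt (x n ^+ 2 + x n.+1 ^+ 2).

(** Resetting coordinate [n.+1] to zero gives a point and its mirror image under [flip n.+1] the
    same chord, as [extend_flip] requires. *)
Definition chord_end n h x : nat -> R :=
  fun i => if i == n then h else if i == n.+1 then 0 else x i.

Definition flip n x : nat -> R := fun i => if i == n then - x i else x i.

Definition coord_cvg {I : Type} (F : set_system I) (f : I -> nat -> R) x :=
  forall k, f i k @[i --> F] --> x k.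

(* Continuity at [x] for the product topology on [nat -> R], phrased with
   arbitrary filters so that precomposition needs no further argument. *)
Definition coord_continuous_at (T : topologicalType) (b : (nat -> R) -> T) x :=
  forall (I : Type) (F : set_system I) (f : I -> nat -> R),
    Filter F -> coord_cvg F f x -> b (f i) @[i --> F] --> b x.

Lemma oppfK x : \- (\- x) = x.
Proof. by apply/funext => i /=; rewrite opprK. Qed.

Lemma chord_end_n n h x : chord_end n h x n = h.
Proof. by rewrite /chord_end eqxx. Qed.

Lemma chord_endN n h x : \- chord_end n h x = chord_end n (- h) (\- x).
Proof.
apply/funext => i /=; rewrite /chord_end.
by case: ifP => //; case: ifP; rewrite ?oppr0.
Qed.

Lemma chord_end_id n h x : x n = h -> x n.+1 = 0 -> chord_end n h x = x.
Proof.
move=> xn xn1; apply/funext => i; rewrite /chord_end.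
by case: eqP => [->|_] //; case: eqP => [->|].
Qed.

Lemma flipN n x : flip n (\- x) = \- flip n x.
Proof. by apply/funext => i; rewrite /flip /=; case: ifP. Qed.

Lemma flip_chord_end n h x : flip n (chord_end n h x) = chord_end n (- h) x.
Proof. by apply/funext => i; rewrite /flip /chord_end; case: eqP. Qed.

Lemma chord_end_flip n h x : chord_end n h (flip n.+1 x) = chord_end n h x.
Proof.
by apply/funext => i; rewrite /flip /chord_end; case: eqP => // _; case: eqP.
Qed.

Lemma half_chordN n x : half_chord n (\- x) = half_chord n x.
Proof. by rewrite /half_chord /= !sqrrN. Qed.

Lemma half_chord_flip n x : half_chord n (flip n.+1 x) = half_chord n x.
Proof. by rewrite /half_chord /flip eqxx ltn_eqF// sqrrN. Qed.

Lemma half_chord_gt0 n x : (0 < half_chord n x) = (x n != 0) || (x n.+1 != 0).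
Proof.
rewrite /half_chord sqrtr_gt0 lt0r addr_ge0 ?sqr_ge0// andbT.
by rewrite paddr_eq0 ?sqr_ge0// !sqrf_eq0 negb_and.
Qed.

Lemma half_chord_edge n x : x n.+1 = 0 -> half_chord n x = `|x n|.
Proof. by move=> x0; rewrite /half_chord x0 expr0n addr0 sqrtr_sqr. Qed.

Section limits.
Context {I : Type} (F : set_system I) (FF : Filter F) (f : I -> nat -> R).
Context (x : nat -> R) (fx : coord_cvg F f x).

Lemma coord_cvgN : coord_cvg F (fun i => \- f i) (\- x).
Proof. by move=> k; exact: cvgN. Qed.

Lemma half_chord_cvg n : half_chord n (f i) @[i --> F] --> half_chord n x.
Proof.
apply: (cvg_at FF (@sqrt_continuous R _)).
by apply: cvgD; rewrite expr2; under eq_cvg do rewrite expr2; exact: cvgM.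
Qed.

Lemma chord_end_cvg n (h : I -> R) h' : h @ F --> h' ->
  coord_cvg F (fun i => chord_end n (h i) (f i)) (chord_end n h' x).
Proof.
move=> hh k; rewrite /chord_end; case: eqP => _ //.
by case: eqP => _ //; exact: cvg_cst.
Qed.

End limits.

Lemma nonzero_pos_neg n x : nonzero_upto n x ->
  positive_upto n x \/ positive_upto n (\- x).
Proof.
elim: n => [|n IH] [i].
  rewrite leqn0 => /eqP->; case: ltgtP => // x0 _; [right|left].
    exists 0%N; split=> //=; first by rewrite oppr_gt0.
    by move=> j; rewrite leqn0 lt0n => /andP[/negbTE->].
  by exists 0%N; split=> // j; rewrite leqn0 lt0n => /andP[/negbTE->].
have emp (j : nat) : ~~ (n.+1 < j <= n.+1)%N by rewrite ltnNge andNb.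
case: (ltgtP (x n.+1) 0) => [xn|xn|xn] i_n xi.
- right; exists n.+1; split=> //=; first by rewrite oppr_gt0.
  by move=> j /(negP (emp j)).
- by left; exists n.+1; split=> // j /(negP (emp j)).
have : nonzero_upto n x.
  exists i => //; move: i_n; rewrite leq_eqVlt => /orP[/eqP iE|//].
  by rewrite iE xn eqxx in xi.
move=> /IH[] [j [jn xj j0]]; [left|right]; exists j; split=> //;
  try exact: leqW.
all: move=> k /andP[jk]; rewrite leq_eqVlt => /orP[/eqP->|kn] /=.
all: by rewrite ?xn ?oppr0//; apply: j0; rewrite jk.
Qed.

Lemma nonzero_uptoN n x : nonzero_upto n x -> nonzero_upto n (\- x).
Proof. by case=> i i_n xi; exists i => //=; rewrite oppr_eq0. Qed.

End coordinates.

(** * The inductive construction of the maps into [Y] *)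

Section stages.
Context (R : realType) (Y Z : topologicalType).
Context (rho : Y -> Y) (sigma : Z -> Z) (phi : Y -> Z).
Context (le : Y -> Y -> Prop) (s : weight R * le_pairs le -> path_space R Y).
Hypothesis rho_cont : continuous rho.
Hypothesis sigma_act : Z2_action sigma.
Hypothesis phi_cont : continuous phi.
Hypothesis phi_equiv : forall y, sigma (phi y) = phi (rho y).
Hypothesis le_pre : Relation_Definitions.preorder Y le.
Hypothesis s_mpa : lifted_mpa phi s.
Hypothesis le_rho : forall y, le y (rho y).
Hypothesis rho_le : forall y0 y1, le (rho y0) (rho y1) <-> le y0 y1.
Hypothesis s_between :
  forall (w : weight R) (p : le_pairs le) (t : unit_interval R),
    le (\val p).1 (s (w, p) t) /\ le (s (w, p) t) (\val p).2.
Context (ystar : Y).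

(** The induction hypothesis: [b] itself is controlled only above the equator, its composite with
    [phi] on the whole punctured space. [stage_flip] makes the two ends of each chord of the next
    stage comparable. *)
Record stage n (b : (nat -> R) -> Y) : Prop := {
  stage_cont : forall x, 0 < x n -> coord_continuous_at b x;
  stage_opp : forall x, 0 < x n -> b (\- x) = rho (b x);
  stage_flip : forall x, 0 < x n -> le (b x) (b (flip n x));
  stage_phi_cont : forall x, nonzero_upto n x ->
    coord_continuous_at (phi \o b) x;
  stage_phi_opp : forall x, nonzero_upto n x ->
    phi (b (\- x)) = sigma (phi (b x));
  stage_between : forall x, positive_upto n x ->
    order_interval le ystar (iter n rho ystar) (b x)
}.

Let le_refl y : le y y.
Proof. exact: (Relation_Definitions.preord_refl _ _ le_pre). Qed.

Let le_trans y x z : le x y -> le y z -> le x z.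
Proof. exact: (Relation_Definitions.preord_trans _ _ le_pre). Qed.

Let default_pair : le_pairs le :=
  exist _ (ystar, ystar)
    (mem_set (le_refl ystar : [set p | le p.1 p.2] (_, _))).

Lemma motion_between w y0 y1 t : le y0 y1 ->
  order_interval le y0 y1 (motion s default_pair w y0 y1 t).
Proof.
move=> le01; have := s_between (insubd (weight1 R) (Order.min w 1))
  (insubd default_pair (y0, y1)) (clamp t).
by rewrite val_le_pair.
Qed.

Definition top_value n (b : (nat -> R) -> Y) x :=
  b (chord_end n (half_chord n x) x).
Definition bottom_value n (b : (nat -> R) -> Y) x :=
  b (chord_end n (- half_chord n x) x).

(** The time is the affine position of [x n] on its chord: 0 at the top end [x n = h], 1 at the
    bottom end [x n = - h], where [h] is the half-chord. *)
Definition hemisphere n b x :=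
  motion s default_pair (half_chord n x) (top_value n b x) (bottom_value n b x)
    ((half_chord n x - x n) / (2 * half_chord n x)).

Definition extend n b x :=
  if 0 < x n.+1 then hemisphere n b x
  else if x n.+1 < 0 then rho (hemisphere n b (\- x)) else b x.

Section step.
Context (n : nat) (b : (nat -> R) -> Y) (bS : stage n b).
Implicit Types x : nat -> R.

Lemma top_le_bottom x : 0 < half_chord n x ->
  le (top_value n b x) (bottom_value n b x).
Proof.
move=> r0; rewrite /top_value /bottom_value -flip_chord_end.
by apply: (stage_flip bS); rewrite chord_end_n.
Qed.

Lemma hemisphere_between x : 0 < half_chord n x ->
  order_interval le (top_value n b x) (bottom_value n b x) (hemisphere n b x).
Proof. by move=> /top_le_bottom; exact: motion_between. Qed.

(** The bottom end is the antipode of the top end of the opposite chord. This moves the argument of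
    [b] to where coordinate [n] is positive, so that [stage_cont] and [stage_between] apply. *)
Lemma bottom_rho x : 0 < half_chord n x ->
  bottom_value n b x = rho (b (chord_end n (half_chord n x) (\- x))).
Proof.
move=> r0; rewrite /bottom_value -(stage_opp bS) ?chord_end_n//.
by rewrite chord_endN oppfK.
Qed.

Lemma hemisphere_cont x : 0 < half_chord n x ->
  coord_continuous_at (hemisphere n b) x.
Proof.
move=> r0 I F f FF fx.
have rf : half_chord n (f i) @[i --> F] --> half_chord n x.
  exact: half_chord_cvg.
have fr0 : \forall i \near F, 0 < half_chord n (f i) by exact: (cvgr_gt _ rf).
have rN0 : half_chord n x != 0 by rewrite gt_eqF.
apply: (motion_cvg s_mpa FF) => //.
- exact: top_le_bottom.
- by apply: (@filterS _ F FF) fr0 => i; exact: top_le_bottom.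
- by apply: (stage_cont bS); [rewrite chord_end_n|exact: chord_end_cvg].
- rewrite bottom_rho//.
  have cN : rho (b (chord_end n (half_chord n (f i)) (\- f i))) @[i --> F] -->
      rho (b (chord_end n (half_chord n x) (\- x))).
    apply: (cvg_at FF (@rho_cont _)); apply: (stage_cont bS) => //.
      by rewrite chord_end_n.
    exact: (chord_end_cvg FF (coord_cvgN FF fx) rf).
  apply: cvg_trans cN; apply: near_eq_cvg.
  by apply: (@filterS _ F FF) fr0 => i ri; rewrite bottom_rho.
- apply: cvgM; first by apply: cvgB => //; exact: fx.
  by apply: cvgV; [rewrite mulf_neq0|apply: cvgM => //; exact: cvg_cst].
Qed.

(** An equatorial point is an end of its own chord: the top end, reached at time 0, if [x n] is
    positive, and the bottom end, reached at time 1, if it is negative. *)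
Lemma hemisphere_edge x : x n.+1 = 0 -> x n != 0 -> hemisphere n b x = b x.
Proof.
move=> x0 xn; have r0 : 0 < half_chord n x by rewrite half_chord_gt0 xn.
have le01 := top_le_bottom r0.
have rE := half_chord_edge x0; rewrite /hemisphere.
case: (ltgtP (x n) 0) xn => // xn _.
  rewrite (motion_ge1 _ s_mpa) //.
    by rewrite /bottom_value chord_end_id// rE ltr0_norm// opprK.
  have -> : half_chord n x - x n = 2 * half_chord n x.
    by rewrite rE ltr0_norm//; lra.
  by rewrite divff// mulf_neq0// gt_eqF.
rewrite (motion_le0 _ s_mpa) //.
  by rewrite /top_value chord_end_id// rE gtr0_norm.
by rewrite rE gtr0_norm// subrr mul0r.
Qed.

Lemma hemisphere_phi_near (I : Type) (F : set_system I) (f : I -> nat -> R)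
    x V :
  Filter F -> coord_cvg F f x -> x n.+1 = 0 -> nonzero_upto n x ->
  nbhs (phi (b x)) V ->
  \forall i \near F, 0 < half_chord n (f i) -> V (phi (hemisphere n b (f i))).
Proof.
move=> FF fx x0 xN0 bV.
have rf : half_chord n (f i) @[i --> F] --> half_chord n x.
  exact: half_chord_cvg.
have [xn|xn] := eqVneq (x n) 0; last first.
  have r0 : 0 < half_chord n x by rewrite half_chord_gt0 xn.
  rewrite -(hemisphere_edge x0 xn) in bV.
  have := hemisphere_cont r0 FF fx (phi_cont bV).
  by apply: (@filterS _ F FF).
have r0 : half_chord n x = 0 by rewrite half_chord_edge// xn normr0.
rewrite r0 in rf.
have [U [delta [bU delta0 small]]] := lifted_mpa_small s_mpa bV.
(* [h] will be the identity for top ends and negation for bottom ends. Both ends tend to [x], which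
   is the end of its own degenerate chord. *)
have cvg_fold (h : R -> R) : {for 0, continuous h} -> h 0 = 0 ->
    phi (b (chord_end n (h (half_chord n (f i))) (f i))) @[i --> F]
      --> phi (b x).
  move=> h_cont h0; apply: (stage_phi_cont bS xN0 FF).
  rewrite -(chord_end_id xn x0); apply: (chord_end_cvg FF fx).
  by rewrite -[X in _ --> X]h0; apply: (cvg_at FF h_cont).
have topU := cvg_fold id cvg_id erefl U bU.
have oppr_cont : {for 0, continuous (@GRing.opp R)} by exact: opp_continuous.
have bottomU := cvg_fold (@GRing.opp R) oppr_cont (oppr0 _) U bU.
have near_r : \forall i \near F, half_chord n (f i) < delta.
  by exact: (cvgr_lt _ rf).
near=> i => ri; have le01 := top_le_bottom ri.
apply: small; rewrite ?val_le_pair//=.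
- by near: i.
- by near: i.
- by rewrite val_weight// gt_min; apply/orP; left; near: i.
Unshelve. all: by end_near. Qed.

Lemma half_chord_gt0S x : x n.+1 != 0 -> 0 < half_chord n x.
Proof. by rewrite half_chord_gt0 => ->; rewrite orbT. Qed.

Lemma extend_pos x : 0 < x n.+1 -> extend n b x = hemisphere n b x.
Proof. by rewrite /extend => ->. Qed.

Lemma extend_neg x : x n.+1 < 0 -> extend n b x = rho (hemisphere n b (\- x)).
Proof. by move=> x0; rewrite /extend x0 ltNge ltW. Qed.

Lemma extend_edge x : x n.+1 = 0 -> extend n b x = b x.
Proof. by move=> x0; rewrite /extend x0 ltxx. Qed.

Lemma extend_cont x : 0 < x n.+1 -> coord_continuous_at (extend n b) x.
Proof.
move=> x0 I F f FF fx; rewrite extend_pos//.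
have r0 : 0 < half_chord n x by rewrite half_chord_gt0S// gt_eqF.
apply: cvg_trans (hemisphere_cont r0 FF fx); apply: near_eq_cvg.
have : \forall i \near F, 0 < f i n.+1 by exact: (cvgr_gt _ (fx n.+1)).
by apply: (@filterS _ F FF) => i fi; rewrite extend_pos.
Qed.

Lemma extend_opp x : 0 < x n.+1 -> extend n b (\- x) = rho (extend n b x).
Proof. by move=> x0; rewrite extend_neg/= ?oppr_lt0// oppfK extend_pos. Qed.

(** The antipode of [flip n.+1 x] lies above the equator and projects to the chord opposite to that
    of [x]. Both values are compared with [rho] of [b] at the top end of that opposite chord. *)
Lemma extend_flip x : 0 < x n.+1 ->
  le (extend n b x) (extend n b (flip n.+1 x)).
Proof.
move=> x0; have r0 : 0 < half_chord n x by rewrite half_chord_gt0S// gt_eqF.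
rewrite extend_pos// extend_neg; last by rewrite /flip eqxx oppr_lt0.
have [_ /le_trans] := hemisphere_between r0; apply; rewrite bottom_rho//.
apply/rho_le; rewrite -flipN.
have ry : half_chord n (flip n.+1 (\- x)) = half_chord n x.
  by rewrite half_chord_flip half_chordN.
have [] := hemisphere_between (x := flip n.+1 (\- x)); first by rewrite ry.
by rewrite /top_value ry chord_end_flip.
Qed.

Lemma nonzero_upto_pred x :
  x n.+1 = 0 -> nonzero_upto n.+1 x -> nonzero_upto n x.
Proof.
move=> x0 [i]; rewrite leq_eqVlt => /orP[/eqP->|i_n xi].
  by rewrite x0 eqxx.
by exists i.
Qed.

(** Below the equator [extend] at [x] is [rho] of its value at the antipode; since [rho] need not be
    an involution, the way back uses that [sigma] is one. *)
Lemma extend_phi_opp x : nonzero_upto n.+1 x ->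
  phi (extend n b (\- x)) = sigma (phi (extend n b x)).
Proof.
move=> xN0; case: (ltgtP (x n.+1) 0) => [x0|x0|x0].
- have -> : extend n b x = rho (extend n b (\- x)).
    by rewrite -extend_opp/= ?oppr_gt0// oppfK.
  by rewrite -phi_equiv (sigma_act.2 _).
- by rewrite extend_opp// phi_equiv.
- rewrite !extend_edge//= ?x0 ?oppr0//.
  exact: (stage_phi_opp bS (nonzero_upto_pred x0 xN0)).
Qed.

Lemma extend_phi_cont x : nonzero_upto n.+1 x ->
  coord_continuous_at (phi \o extend n b) x.
Proof.
move=> xN0 I F f FF fx.
case: (ltgtP (x n.+1) 0) => [x0|x0|x0].
- have nx0 : 0 < (\- x) n.+1 by rewrite /= oppr_gt0.
  have c := extend_cont nx0 FF (coord_cvgN FF fx).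
  have c' := cvg_at FF (@phi_cont _) (cvg_at FF (@rho_cont _) c).
  have -> : (phi \o extend n b) x = phi (rho (extend n b (\- x))).
    by rewrite -extend_opp ?oppfK.
  apply: cvg_trans c'; apply: near_eq_cvg.
  have : \forall i \near F, f i n.+1 < 0 by exact: (cvgr_lt _ (fx n.+1)).
  apply: (@filterS _ F FF) => i fi.
  by rewrite -extend_opp/= ?oppr_gt0// oppfK.
- exact: (cvg_at FF (@phi_cont _) (extend_cont x0 FF fx)).
have xN := nonzero_upto_pred x0 xN0.
rewrite /= extend_edge// => V bV.
have upper := hemisphere_phi_near FF fx x0 xN bV.
have nx0 : (\- x) n.+1 = 0 by rewrite /= x0 oppr0.
(* Below the equator [extend] is [rho] of [hemisphere] at the antipode, and [phi] turns [rho] into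
   [sigma]; hence the estimate is taken at [\- x] for the preimage of [V] under [sigma]. *)
have sV : nbhs (phi (b (\- x))) (sigma @^-1` V).
  apply: sigma_act.1; rewrite (stage_phi_opp bS xN).
  by rewrite (sigma_act.2 _).
have lower :=
  hemisphere_phi_near FF (coord_cvgN FF fx) nx0 (nonzero_uptoN xN) sV.
have edge : \forall i \near F, V (phi (b (f i))).
  exact: (stage_phi_cont bS xN FF fx bV).
change (\forall i \near F, V (phi (extend n b (f i)))); near=> i.
rewrite /extend; case: (ltgtP (f i n.+1) 0) => fi.
- rewrite -phi_equiv.
  apply: (near lower i) => //.
  by rewrite half_chordN half_chord_gt0S// lt_eqF.
- by apply: (near upper i) => //; rewrite half_chord_gt0S// gt_eqF.
- exact: (near edge i).
Unshelve. all: by end_near. Qed.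

(** The additional [rho] in the upper bound comes from the bottom end of the chord, which is [rho]
    of a value at most [iter n rho ystar]. *)
Lemma extend_between x : positive_upto n.+1 x ->
  order_interval le ystar (iter n.+1 rho ystar) (extend n b x).
Proof.
case=> i [i_n xi xj].
have chord_end_pos (h : R) y : 0 < h -> positive_upto n (chord_end n h y).
  move=> h0; exists n; split=> //; first by rewrite chord_end_n.
  by move=> j; rewrite ltnNge andNb.
case: (ltngtP i n.+1) i_n => // [i_n _|iE _].
  have x0 : x n.+1 = 0 by apply: xj; rewrite i_n leqnn.
  have [] : order_interval le ystar (iter n rho ystar) (b x).
    apply: (stage_between bS); exists i; split=> // j /andP[ij jn].
    by apply: xj; rewrite ij leqW.
  rewrite extend_edge// => yb by_; split=> //=; apply: le_trans by_ _.
  exact: le_rho.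
have x0 : 0 < x n.+1 by rewrite -iE.
have r0 : 0 < half_chord n x by rewrite half_chord_gt0S// gt_eqF.
rewrite extend_pos//; have [lo hi] := hemisphere_between r0; split.
  have [yb _] := stage_between bS (chord_end_pos _ x r0).
  exact: le_trans yb lo.
apply: le_trans hi _; rewrite bottom_rho//=; apply/rho_le.
by have [] := stage_between bS (chord_end_pos _ (\- x) r0).
Qed.

Lemma stage_extend : stage n.+1 (extend n b).
Proof.
split.
- exact: extend_cont.
- exact: extend_opp.
- exact: extend_flip.
- exact: extend_phi_cont.
- exact: extend_phi_opp.
- exact: extend_between.
Qed.

End step.

(** Away from zero the function is locally constant. At level 0 reflection and antipode agree on the
    only relevant coordinate, so [stage_flip] reduces to [le_rho]. *)
Lemma stage_start : stage 0 (fun x => if 0 < x 0%N then ystar else rho ystar).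
Proof.
have nonzero0 (x : nat -> R) : nonzero_upto 0 x -> x 0%N != 0.
  by case=> i; rewrite leqn0 => /eqP->.
split=> x /=.
- move=> x0 I F f FF fx; rewrite x0; apply: cvg_near_cst.
  have : \forall i \near F, 0 < f i 0%N by exact: (cvgr_gt _ (fx 0%N)).
  by apply: (@filterS _ F FF) => i ->.
- by move=> x0; rewrite x0 oppr_gt0 ltNge ltW.
- by move=> x0; rewrite /flip eqxx x0 oppr_gt0 ltNge ltW.
- move=> /nonzero0 x0 I F f FF fx; apply: cvg_near_cst.
  move: x0; rewrite neq_lt => /orP[x0|x0].
    have : \forall i \near F, f i 0%N < 0 by exact: (cvgr_lt _ (fx 0%N)).
    by apply: (@filterS _ F FF) => i fi; rewrite /= !ltNge !ltW.
  have : \forall i \near F, 0 < f i 0%N by exact: (cvgr_gt _ (fx 0%N)).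
  by apply: (@filterS _ F FF) => i fi; rewrite /= x0 fi.
- move=> /nonzero0; rewrite oppr_gt0.
  by case: ltgtP => // _ _; rewrite -phi_equiv ?(sigma_act.2 _).
- by case=> i []; rewrite leqn0 => /eqP-> -> _; split.
Qed.

Lemma exists_stage n : exists b, stage n b.
Proof.
elim: n => [|n [b bS]]; first by eexists; exact: stage_start.
by exists (extend n b); exact: stage_extend.
Qed.

End stages.

(** * Passage from the sphere to coordinate sequences *)

Section sphere_coordinates.
Context {R : realType} {n : nat}.
Implicit Types x : sphere R n.

(* Only the indices [i <= n] are meaningful; [inord] sends the others to [0]. *)
Definition coords x : nat -> R := fun i => \val x 0 (inord i).

Lemma coords_antipode x : coords (antipode x) = \- coords x.
Proof. by apply/funext => i; rewrite /coords /= mxE. Qed.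

Lemma coords_cvg x : coord_cvg (nbhs x) coords (coords x).
Proof.
move=> i.
apply: (cvg_at (g := fun M : 'rV[R]_n.+1 => M 0 (inord i)) _ (u := \val)).
  exact: coord_continuous.
exact: initial_continuous.
Qed.

Lemma coords_nonzero x : nonzero_upto n (coords x).
Proof.
apply: contrapT => x0; have := set_mem (valP x); rewrite /sphere_set /=.
rewrite big1 => [/esym/eqP|i _]; first by rewrite oner_eq0.
apply/eqP; rewrite sqrf_eq0; apply: contra_notT x0 => xi.
by exists (val i); [exact: (ltn_ord i)|rewrite /coords inord_val].
Qed.

Lemma coords_positive x : positive_point x <-> positive_upto n (coords x).
Proof.
split=> [[i [xi x0]]|[i [i_n xi x0]]].
  exists i; rewrite /coords inord_val; split=> //; first exact: (ltn_ord i).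
  by move=> j /andP[ij jn]; apply: x0; rewrite inordK.
exists (inord i); split=> // j; rewrite inordK// => ij.
by rewrite -(x0 j) /coords ?inord_val// ij -ltnS ltn_ord.
Qed.

Lemma positive_or_antipode x : positive_point x \/ positive_point (antipode x).
Proof.
rewrite !coords_positive coords_antipode.
exact: nonzero_pos_neg (coords_nonzero x).
Qed.

End sphere_coordinates.

Theorem theorem3p5 (R : realType) (Y Z : topologicalType)
    (rho : Y -> Y) (sigma : Z -> Z) (phi : Y -> Z)
    (le : Y -> Y -> Prop)
    (s : weight R * le_pairs le -> path_space R Y)
    (Yne : [set: Y] !=set0)
    (rho_homeo : homeomorphism rho)
    (sigma_act : Z2_action sigma)
    (phi_cont : continuous phi)
    (phi_equiv : forall y, sigma (phi y) = phi (rho y))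
    (le_pre : Relation_Definitions.preorder Y le)
    (s_mpa : lifted_mpa phi s)
    (le_rho : forall y, le y (rho y))
    (rho_le : forall y0 y1, le (rho y0) (rho y1) <-> le y0 y1)
    (s_between : forall (w : weight R) (p : le_pairs le) (t : unit_interval R),
      le (\val p).1 (s (w, p) t) /\ le (s (w, p) t) (\val p).2) :
  [/\ forall n : nat, exists beta : sphere R n -> Z, Z2_map sigma beta,
      forall (ystar : Y) (n : nat), exists beta : sphere R n -> Z,
        Z2_map sigma beta /\
        forall x : sphere R n, positive_point x ->
          exists y : Y, [/\ le ystar y, le y (iter n rho ystar)
                          & beta x = phi y]
    & forall (ystar : Y) (n : nat),
        let A := phi @` order_interval le ystar (iter n rho ystar) in
        exists hW : stable_set sigma (A `|` sigma @` A),
          Z2_coindex_ge R n (restr_action hW)].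
Proof.
have main (ystar : Y) (n : nat) : exists beta : sphere R n -> Z,
    Z2_map sigma beta /\
    forall x : sphere R n, positive_point x ->
      exists y : Y, [/\ le ystar y, le y (iter n rho ystar) & beta x = phi y].
  have [b bS] := exists_stage rho_homeo.1 sigma_act phi_cont phi_equiv le_pre
    s_mpa le_rho rho_le s_between ystar n.
  exists (fun x => phi (b (coords x))); split; [split=> x|].
  - exact: (stage_phi_cont bS (coords_nonzero x) _ (@coords_cvg R n x)).
  - by rewrite coords_antipode (stage_phi_opp bS (coords_nonzero x)).
  move=> x /coords_positive /(stage_between bS)[lo hi].
  by exists (b (coords x)).
split=> //.
  by case: Yne => y _ n; have [beta []] := main y n; exists beta.
move=> ystar n A.
have hW : stable_set sigma (A `|` sigma @` A).
  move=> z [Az|[a Aa <-]]; first by right; exists z.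
  by left; rewrite (sigma_act.2 a).
exists hW; have [beta [[beta_cont beta_anti] beta_pos]] := main ystar n.
have posA x : positive_point x -> A (beta x).
  by move=> /beta_pos[y [lo hi ->]]; exists y.
have betaW x : (A `|` sigma @` A) (beta x).
  (* If the antipode is the positive point, then [sigma (beta x)] lies in [A], and applying [sigma]
     again puts [beta x] in the image of [A]. *)
  case: (positive_or_antipode x) => /posA; first by left.
  rewrite beta_anti => Ax; right.
  by exists (sigma (beta x)); rewrite ?sigma_act.2.
exists (fun x => exist _ (beta x) (mem_set (betaW x))); split=> x.
  by apply: cvg_set_type; [exact: nbhs_filter|exact: (beta_cont x)].
by apply: val_inj; rewrite /= beta_anti.
Qed.
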